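(* Let $0\leq n<N$ be integers and let $f$ be a finite Blaschke product of degree $N$. Assume that the modulus of the zeros of $f$ does not exceed $\lambda\in(0,1)$, and put $\alpha_0:=\frac{1-\lambda}{1+\lambda}$. For each $\alpha\in(0,\alpha_0)$, let $$s^{*}:=\frac{\alpha^{-1}-1+(\alpha^{-1}+1)\lambda^{2}}{2\lambda\alpha^{-1}}+\sqrt{\left(\frac{\alpha^{-1}-1+(\alpha^{-1}+1)\lambda^{2}}{2\lambda\alpha^{-1}}\right)^{2}-1}\ \in(1,1/\lambda).$$ Then $$d_2(f,\mathcal{R}_{n,n})\ \geq\ \sup_{\beta\in[0,1]}\sqrt{\alpha\left(1-\frac{n}{N}-\left(\frac{s^*-\lambda}{1-\lambda s^*}\right)^{2N}(n+1)^\beta\,\operatorname{Li}_\beta\!\left((s^* )^{-2}\right)\frac{(s^* )^{2(2-[N/\alpha])}}{N\left((s^* )^2-1\right)^2}\right)}$$ as soon as the quantity under the square root is non-negative (that is, the lower bound holds for every $\beta\in[0,1]$ for which the quantity under the square root is non-negative), where $[N/\alpha]$ denotes the integer part of $N/\alpha$.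
   Context: $\mathbb{D}$ is the open unit disk and $\mathbb{T}$ the unit circle in $\mathbb{C}$. $L^2=L^2(\mathbb{T})$ carries the normalized norm $\|f\|_2=\left(\frac{1}{2\pi}\int_0^{2\pi}|f(e^{i\theta})|^2\,d\theta\right)^{1/2}$. $\mathcal{P}_n$ is the space of complex polynomials of degree at most $n$. $\mathcal{R}_{n,n}$ is the set of rational functions that can be written $p/q$ with $p\in\mathcal{P}_n$ and $q\in\mathcal{P}_n$ having no roots on $\mathbb{T}$. For $f\in L^2$, $d_2(f,\mathcal{R}_{n,n})=\inf_{r\in\mathcal{R}_{n,n}}\|f-r\|_2$. A finite Blaschke product of degree $N$ is a function $c\prod_{i=1}^N\frac{z-\zeta_i}{1-\overline{\zeta_i}z}$ with $|c|=1$ and $\zeta_i\in\mathbb{D}$ (repetitions allowed). The polylogarithm is $\operatorname{Li}_\beta(x)=\sum_{\ell\geq1}x^\ell/\ell^\beta$ for $|x|<1$. *)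

(* Defs.v *)
(* The complex numbers are [R[i]], over an arbitrary [R : realType]. *)
From HB Require Import structures.
From mathcomp Require Import all_boot all_order all_algebra.
From mathcomp Require Import all_classical all_reals all_analysis.
From mathcomp Require Export complex.

Set Implicit Arguments.
Unset Strict Implicit.
Unset Printing Implicit Defensive.

Import Order.TTheory GRing.Theory Num.Theory.
Import numFieldNormedType.Exports.

Local Open Scope classical_set_scope.
Local Open Scope ring_scope.
Local Open Scope complex_scope.

(* [normc z] is the modulus of [z] as an element of [R]; the generic [`|z|] is
   the same number, seen in [R[i]]. *)
Notation normc := Normc.normc.

(* e^{i t} *)
Definition cis (R : realType) (t : R) : R[i] := cos t +i* sin t.

Definition normL2 (R : realType) (f : R[i] -> R[i]) : \bar R :=
  (((2 * pi)^-1%:E *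
     \int[lebesgue_measure]_(t in `[0%R, (2 * pi)%R]) (normc (f (cis t)) ^+ 2)%:E)
   `^ 2^-1)%E.

(* Totalized division makes [p.[z] / q.[z]] equal to 0 at the zeros of [q];
   these lie off the unit circle, where the values of [r] are irrelevant to
   [normL2].  The condition on [q] forces [q != 0]. *)
Definition ratfun (R : realType) (n : nat) : set (R[i] -> R[i]) :=
  [set r | exists p q : {poly R[i]},
    [/\ (size p <= n.+1)%N, (size q <= n.+1)%N,
        forall z : R[i], `|z| = 1 -> ~~ root q z
      & r = (fun z => p.[z] / q.[z])]].

Definition dist2_rat (R : realType) (f : R[i] -> R[i]) (n : nat) : \bar R :=
  ereal_inf [set normL2 (fun z => f z - r z) | r in @ratfun R n].

(* At a pole [1 / (zeta i)^*] the totalized quotient is 0; the poles lie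
   outside the closed unit disk. *)
Definition finite_blaschke (R : realType) (N : nat) (f : R[i] -> R[i]) : Prop :=
  exists (c : R[i]) (zeta : 'I_N -> R[i]),
    [/\ `|c| = 1,
        forall i, `|zeta i| < 1
      & f = (fun z => c * \prod_(i < N) ((z - zeta i) / (1 - (zeta i)^* * z)))].

(* Only meaningful for [`|x| < 1]. *)
Definition polylog (R : realType) (beta x : R) : R :=
  \big[+%R/0]_(1 <= l <oo) (x ^+ l / l%:R `^ beta).

(* The larger root of s + 1/s = 2 m, where
   m = (1/alpha - 1 + (1/alpha + 1) lambda^2) / (2 lambda / alpha). *)
Definition s_star (R : realType) (lambda alpha : R) : R :=
  let m := (alpha^-1 - 1 + (alpha^-1 + 1) * lambda ^+ 2)
             / (2 * lambda * alpha^-1) in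
  m + Num.sqrt (m ^+ 2 - 1).

(* [s ^ k] with [k : int] is the integer power. *)
Definition radicand (R : realType) (n N : nat) (lambda alpha beta : R) : R :=
  let s := s_star lambda alpha in
  alpha * (1 - n%:R / N%:R
           - ((s - lambda) / (1 - lambda * s)) ^+ (2 * N)
             * n.+1%:R `^ beta * polylog beta (s ^- 2)
             * (s ^ (2 * (2 - Num.floor (N%:R / alpha)))
                / (N%:R * (s ^+ 2 - 1) ^+ 2))).

(* Main.v *)
Require Import Defs.
From mathcomp Require Import all_boot all_order all_algebra.
From mathcomp Require Import all_classical all_reals all_analysis.
From mathcomp Require Import zify ring lra.

(** Why the bound holds.  Let [f] be the Blaschke product, [r = p / q] with [p]
    and [q] of degree at most [n], and let [L] be the integer part of
    [N / alpha].  For [g] on the circle consider the Hankel matrix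
    [g^(j + k + 1)] of Fourier coefficients, with [L] rows [j < L] and many
    columns [k].  Each row has squared norm at most [||g||^2], so the squared
    Frobenius norm of the matrix of [f - r] is at most [L * ||f - r||^2].  It
    can also be bounded below:
    - the matrix of [r] has rank at most [n], because [q * r = p] is a linear
      recurrence for the Fourier coefficients of [r] of index greater than [n];
    - the matrix of [f] is a contraction, because [|f| = 1] on the circle, so
      subtracting a matrix of rank [n] from it lowers the squared Frobenius
      norm by at most [n] ([frob_low_rank]);
    - the squared Frobenius norm of the matrix of [f] is the sum of
      [min(m, L) * |f_m|^2], that is, the Dirichlet sum of [m * |f_m|^2],
      which equals [N], minus the sum of [(m - L) * |f_m|^2] over [m > L].
    As [|f| <= kappa^N] on [|z| = s], where [kappa = (s - lambda) / (1 - lambda * s)],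
    the Bernoulli inequality [k * (s^2 - 1) <= s^(2 k)] and Parseval's identity
    on that circle bound the last sum by
    [tau = kappa^(2 N) / (s^(2 L) * (s^2 - 1))].  Altogether
    [L * ||f - r||^2 >= N - n - tau], for every [s] between [1] and
    [1 / lambda].  Since [Li_beta(x) >= x] and [(n + 1)^beta >= 1], the error
    term of the theorem is at least [tau / N], whatever [beta] in [[0, 1]].

    Integrals are avoided until the end.  All Fourier analysis is done with
    averages over [M] equally spaced points of the circle, which are exact on
    polynomials of degree less than [M] ([hankel_lower_bound]).  To this end
    [f] is replaced by a polynomial, obtained by truncating the geometric
    series in each Blaschke factor; a coefficient identity
    ([dirichlet_blaschke_factor]) shows that each truncated factor raises the
    Dirichlet sum by almost [1] ([blaschke_poly_approx]).  The resulting lower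
    bound holds for every rotation of the grid, with the same constant;
    averaging over the rotations turns it into a bound on the integral
    ([integral_ge_grid_sums]). *)

Set Implicit Arguments.
Unset Strict Implicit.
Unset Printing Implicit Defensive.

Import Order.TTheory GRing.Theory Num.Theory.
Import numFieldNormedType.Exports.

Local Open Scope classical_set_scope.
Local Open Scope ring_scope.

(** * Low-rank perturbations in the Frobenius norm *)

Lemma sum_ord_widen (V : nmodType) (a b : nat) (F : nat -> V) : (a <= b)%N ->
  (forall m, (a <= m)%N -> F m = 0) -> \sum_(m < a) F m = \sum_(m < b) F m.
Proof.
move=> ab F0; rewrite -(subnKC ab) big_split_ord /=.
by rewrite [X in _ = _ + X]big1 ?addr0 // => i _; rewrite F0 ?leq_addr.
Qed.

Section LowRank.
Variable C : numClosedFieldType.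
Local Open Scope sesquilinear_scope.

(** The squared Frobenius norm. *)
Definition frob m n (A : 'M[C]_(m, n)) : C := \sum_i \sum_j `|A i j| ^+ 2.

Lemma frob_trace m n (A : 'M[C]_(m, n)) : frob A = \tr (A *m A ^t*).
Proof.
apply: eq_bigr => i _; rewrite mxE; apply: eq_bigr => j _.
by rewrite !mxE normCK.
Qed.

Lemma frob_ge0 m n (A : 'M[C]_(m, n)) : 0 <= frob A.
Proof. by do 2!(apply: sumr_ge0 => ? _); rewrite exprn_ge0. Qed.

(** Pythagoras: [A *m X ^t* *m X] is the projection of the rows of [A] to the
    space spanned by the orthonormal rows of [X], which contains the rows of
    [Y *m X]. *)
Lemma frob_sub_proj m n r (A : 'M[C]_(m, n)) (Y : 'M[C]_(m, r)) (X : 'M[C]_(r, n)) :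
  X \is unitarymx ->
  frob (A - Y *m X) = frob A - frob (A *m X ^t*) + frob (A *m X ^t* - Y).
Proof.
move=> /unitarymxP XX; rewrite !frob_trace.
have tB p (P Q : 'M[C]_(m, p)) : (P - Q)^t* = P^t* - Q^t*.
  by rewrite linearB /= map_mxB.
rewrite !tB.
rewrite !mulmxBl !mulmxBr !trmx_mul !map_mxM !linearB /=.
have -> : Y *m X *m (X ^t* *m Y ^t*) = Y *m Y ^t*.
  by rewrite !mulmxA -(mulmxA Y) XX mulmx1.
rewrite trmxCK !mulmxA; ring.
Qed.

(** Orthonormalize the row space of [B] into [X].  By Pythagoras, replacing [A]
    by [A - B] can only remove the part of [A] along [X]; each of the [\rank B]
    orthonormal rows of [X] contributes at most [S] to it. *)
Lemma frob_low_rank m n (A B : 'M[C]_(m, n)) (S : C) :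
  (forall v : 'cV_n, frob (A *m v) <= S * frob v) ->
  frob A - (\rank B)%:R * S <= frob (A - B).
Proof.
move=> AS; pose X := schmidt (row_base B).
have uX : X \is unitarymx by rewrite schmidt_unitarymx ?rank_leq_col.
have /submxP[Y defB] : (B <= X)%MS.
  by rewrite (submx_trans _ (schmidt_sub _)) ?eq_row_base.
rewrite [in leRHS]defB frob_sub_proj // -[leLHS]addr0 lerD ?frob_ge0 //.
rewrite lerB // /frob exchange_big /=.
rewrite mulr_natl -[X in S *+ X]card_ord -sumr_const; apply: ler_sum => k _.
have := AS (col k (X ^t*)).
have -> : frob (col k (X ^t*)) = 1.
  have /unitarymxP/matrixP/(_ k k) := uX; rewrite !mxE eqxx mulr1n => <-.
  apply: eq_bigr => i _; rewrite big_ord1 !mxE norm_conjC normCK //.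
rewrite mulr1; apply: le_trans; apply: ler_sum => i _.
by rewrite big_ord1 colE mulmxA -colE !mxE.
Qed.
End LowRank.

(** * Fourier analysis on a rotated grid of roots of unity *)

Section Grid.
Variables (C : numClosedFieldType) (M : nat) (w c : C).
Hypotheses (prim_w : M.-primitive_root w) (norm_c : `|c| = 1).

(** The letter g stands for grid: this is not a geometric mean.  The factor [c]
    rotates the grid. *)
Definition gmean (h : C -> C) : C := M%:R^-1 * \sum_(k < M) h (c * w ^+ k).

Let M_gt0 : (0 < M)%N. Proof. exact: prim_order_gt0 prim_w. Qed.

Let M_neq0 : M%:R != 0 :> C. Proof. by rewrite pnatr_eq0 -lt0n. Qed.

Lemma norm_prim_root : `|w| = 1.
Proof.
apply/eqP; rewrite -(@pexpr_eq1 _ _ M) // -normrX (prim_expr_order prim_w).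
by rewrite normr1.
Qed.

Lemma norm_node k : `|c * w ^+ k| = 1.
Proof. by rewrite normrM normrX norm_prim_root norm_c expr1n mulr1. Qed.

Lemma eq_gmean h1 h2 :
  (forall k, h1 (c * w ^+ k) = h2 (c * w ^+ k)) -> gmean h1 = gmean h2.
Proof. by move=> h12; congr (_ * _); apply: eq_bigr => k _. Qed.

Lemma gmeanD h1 h2 : gmean (fun z => h1 z + h2 z) = gmean h1 + gmean h2.
Proof. by rewrite /gmean big_split mulrDr. Qed.

Lemma gmeanZ a h : gmean (fun z => a * h z) = a * gmean h.
Proof. by rewrite /gmean -mulr_sumr mulrCA. Qed.

Lemma gmeanN h : gmean (fun z => - h z) = - gmean h.
Proof. by rewrite /gmean sumrN mulrN. Qed.

Lemma gmean_sum I (r : seq I) (P : pred I) (h : I -> C -> C) :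
  gmean (fun z => \sum_(i <- r | P i) h i z) = \sum_(i <- r | P i) gmean (h i).
Proof. by rewrite /gmean exchange_big /= mulr_sumr. Qed.

Lemma gmean_conj h : gmean (fun z => (h z)^*) = (gmean h)^*.
Proof.
rewrite /gmean rmorphM /= fmorphV rmorph_nat rmorph_sum /=; congr (_ * _).
Qed.

Lemma gmean_cst a : gmean (fun=> a) = a.
Proof.
by rewrite /gmean sumr_const card_ord -[a *+ M]mulr_natl mulrA mulVf ?mul1r.
Qed.

Lemma gmean_le h1 h2 :
  (forall k, h1 (c * w ^+ k) <= h2 (c * w ^+ k)) -> gmean h1 <= gmean h2.
Proof.
by move=> h12; rewrite ler_wpM2l ?invr_ge0 ?ler0n // ler_sum.
Qed.

(** On the unit circle the conjugate is the inverse, so this is a geometric sum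
    of an [M]-th root of unity, which vanishes unless that root is [1]. *)
Lemma gmean_monomial a b : (a < M)%N -> (b < M)%N ->
  gmean (fun z => z ^+ a * (z ^+ b)^*) = (a == b)%:R.
Proof.
move=> aM bM.
have cE : c^* = c^-1 by rewrite [RHS]invC_norm norm_c expr1n invr1 mul1r.
have wE : w^* = w^-1.
  by rewrite [RHS]invC_norm norm_prim_root expr1n invr1 mul1r.
have c0 : c != 0 by rewrite -normr_eq0 norm_c oner_eq0.
have w0 : w != 0 by rewrite -normr_eq0 norm_prim_root oner_eq0.
pose u := w ^+ a / w ^+ b.
rewrite (@eq_gmean _ (fun z => z ^+ a / z ^+ b)) => [|k]; last first.
  by rewrite rmorphXn rmorphM rmorphXn /= cE wE exprVn -invfM -exprVn.
rewrite /gmean (eq_bigr (fun k : 'I_M => c ^+ a / c ^+ b * u ^+ k)); last first.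
  by move=> k _; rewrite /u !exprMn exprVn -!exprM ![(k * _)%N]mulnC invfM; ring.
rewrite -mulr_sumr; have [ab|nab] := eqVneq a b.
  rewrite (eq_bigr (fun=> 1)) => [|k _]; last first.
    by rewrite /u -ab divff ?expf_neq0 // expr1n.
  by rewrite sumr_const card_ord ab divff ?expf_neq0 // mul1r mulVf.
have u1 : u != 1.
  rewrite -subr_eq0 -(mulIr_eq0 _ (mulIf (expf_neq0 b w0))) mulrBl mul1r.
  by rewrite divfK ?expf_neq0 // subr_eq0 (eq_prim_root_expr prim_w) !modn_small.
suff -> : \sum_(k < M) u ^+ k = 0 by rewrite !mulr0.
apply: (mulfI (x := u - 1)); first by rewrite subr_eq0.
rewrite -subrX1 mulr0 /u expr_div_n -!exprM ![(_ * M)%N]mulnC !exprM.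
by rewrite (prim_expr_order prim_w) !expr1n divr1 subrr.
Qed.

(** The conjugate of [z ^+ m] stands for [z ^- m], which keeps all exponents in
    [nat]. *)
Definition fourier (h : C -> C) (m : nat) : C := gmean (fun z => h z * (z ^+ m)^*).

Lemma fourier_poly (p : {poly C}) m : (size p <= M)%N -> (m < M)%N ->
  fourier (horner p) m = p`_m.
Proof.
move=> pM mM; rewrite /fourier.
rewrite (@eq_gmean _ (fun z => \sum_(i < M) p`_i * (z ^+ i * (z ^+ m)^*))).
  rewrite gmean_sum (bigD1 (Ordinal mM)) //= gmeanZ gmean_monomial // eqxx mulr1.
  rewrite big1 ?addr0 // => i im; rewrite gmeanZ gmean_monomial //.
  by rewrite -val_eqE /= in im; rewrite (negPf im) mulr0.
move=> k; rewrite (horner_coef_wide _ pM) mulr_suml.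
by apply: eq_bigr => i _; rewrite mulrA.
Qed.

Lemma gmean_mul_poly_conj h K (p : {poly C}) : (size p <= K)%N ->
  gmean (fun z => h z * (p.[z])^*) = \sum_(m < K) (p`_m)^* * fourier h m.
Proof.
move=> pK; rewrite /fourier.
rewrite (eq_bigr (fun m : 'I_K => gmean (fun z => (p`_m)^* * (h z * (z ^+ m)^*)))).
  rewrite -gmean_sum; apply: eq_gmean => k.
  rewrite (horner_coef_wide _ pK) rmorph_sum mulr_sumr; apply: eq_bigr => i _.
  by rewrite rmorphM mulrCA.
by move=> m _; rewrite gmeanZ.
Qed.

Lemma parseval_poly K (p : {poly C}) : (size p <= K)%N -> (K <= M)%N ->
  gmean (fun z => `|p.[z]| ^+ 2) = \sum_(m < K) `|p`_m| ^+ 2.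
Proof.
move=> pK KM.
rewrite (@eq_gmean _ (fun z => p.[z] * (p.[z])^*)) => [|k]; last by rewrite normCK.
rewrite (gmean_mul_poly_conj _ pK); apply: eq_bigr => m _.
rewrite fourier_poly ?(leq_trans pK) // ?(leq_trans (ltn_ord m)) //.
by rewrite normCKC.
Qed.

(** The polynomial [p] with coefficients [fourier h i] for [s <= i < s + K] is
    the orthogonal projection of [h], so that the sum is the mean of
    [|h|^2 - |h - p|^2]. *)
Lemma bessel h s K : (s + K <= M)%N ->
  \sum_(k < K) `|fourier h (s + k)| ^+ 2 <= gmean (fun z => `|h z| ^+ 2).
Proof.
move=> sKM.
pose p := \poly_(i < s + K) (if (s <= i)%N then fourier h i else 0).
have pM : (size p <= s + K)%N by exact: size_poly.
have sumE (F : nat -> C) : (forall i, (i < s)%N -> F i = 0) ->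
    \sum_(i < s + K) F i = \sum_(k < K) F (s + k)%N.
  by move=> F0; rewrite big_split_ord /= big1 ?add0r // => i _; exact: F0.
have -> : gmean (fun z => `|h z| ^+ 2) = gmean (fun z => `|h z - p.[z]| ^+ 2)
    + \sum_(k < K) `|fourier h (s + k)| ^+ 2.
  have E1 : gmean (fun z => h z * (p.[z])^*) = \sum_(k < K) `|fourier h (s + k)| ^+ 2.
    rewrite (gmean_mul_poly_conj _ pM).
    rewrite (sumE (fun m => (p`_m)^* * fourier h m)).
      apply: eq_bigr => k _; rewrite coef_poly ltn_add2l ltn_ord leq_addr.
      by rewrite normCKC.
    move=> i ilt; rewrite coef_poly [(s <= i)%N]leqNgt ilt /= if_same.
    by rewrite rmorph0 mul0r.
  have E2 : gmean (fun z => `|p.[z]| ^+ 2) = \sum_(k < K) `|fourier h (s + k)| ^+ 2.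
    rewrite (parseval_poly pM) // (sumE (fun m => `|p`_m| ^+ 2)).
      by apply: eq_bigr => k _; rewrite coef_poly ltn_add2l ltn_ord leq_addr.
    by move=> i ilt; rewrite coef_poly [(s <= i)%N]leqNgt ilt /= if_same normr0 expr0n.
  have E3 : gmean (fun z => (h z)^* * p.[z]) = \sum_(k < K) `|fourier h (s + k)| ^+ 2.
    rewrite (@eq_gmean _ (fun z => (h z * (p.[z])^*)^*)) => [|k].
      rewrite gmean_conj E1 rmorph_sum /=; apply: eq_bigr => k _.
      by rewrite conj_Creal // rpredX // normr_real.
    by rewrite rmorphM /= conjCK.
  rewrite (@eq_gmean _ (fun z => `|h z - p.[z]| ^+ 2 + (h z * (p.[z])^*
      + (h z)^* * p.[z] + - `|p.[z]| ^+ 2))) => [|k].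
    by rewrite gmeanD gmeanD gmeanD gmeanN E1 E2 E3; ring.
  rewrite !normCK rmorphB /=; ring.
rewrite lerDr -[leLHS](gmean_cst 0); apply: gmean_le => k.
by rewrite exprn_ge0.
Qed.

Lemma gmean_le_bound h S :
  (forall k, h (c * w ^+ k) <= S) -> gmean h <= S.
Proof. by move=> hS; rewrite -[leRHS]gmean_cst; exact: gmean_le. Qed.

(** * Hankel matrices of Fourier coefficients *)

(** The index starts at [1]: the antidiagonal of the coefficient [m] then has
    [m] entries when [m <= L], which is its weight in the Dirichlet sum. *)
Definition hankel L K (h : C -> C) : 'M[C]_(L, K) :=
  \matrix_(j < L, k < K) fourier h (j.+1 + k).

Lemma hankelB L K h1 h2 :
  hankel L K (fun z => h1 z - h2 z) = hankel L K h1 - hankel L K h2.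
Proof.
apply/matrixP => j k; rewrite !mxE /fourier -gmeanN -gmeanD.
by apply: eq_gmean => i; rewrite mulrBl.
Qed.

Lemma frob_hankel_le L K h : (L + K <= M)%N ->
  frob (hankel L K h) <= L%:R * gmean (fun z => `|h z| ^+ 2).
Proof.
move=> LKM; rewrite mulr_natl -[X in _ *+ X]card_ord -sumr_const.
apply: ler_sum => j _.
have jKM : (j.+1 + K <= M)%N by rewrite (leq_trans _ LKM) // leq_add2r.
rewrite (le_trans _ (bessel h jKM)) // ler_sum // => k _; by rewrite mxE.
Qed.

(** The Hankel matrix of a function bounded by [sqrt S] on the grid has norm at
    most [sqrt S].  Indeed, with [p] the polynomial whose coefficients are the
    conjugates of those of [v], the entries of [hankel L K h *m v] are the
    Fourier coefficients of [h] times the conjugate of [p]. *)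
Lemma frob_hankel_mul L K h S (v : 'cV[C]_K) : (L < M)%N -> (K <= M)%N ->
  (forall k, `|h (c * w ^+ k)| ^+ 2 <= S) ->
  frob (hankel L K h *m v) <= S * frob v.
Proof.
move=> LM KM hS; pose p := \poly_(k < K) (if insub k is Some i then v i 0 else 0)^*.
have pE (k : 'I_K) : p`_k = (v k 0)^* by rewrite coef_poly ltn_ord valK.
have pK : (size p <= K)%N by exact: size_poly.
have -> : frob v = gmean (fun z => `|p.[z]| ^+ 2).
  rewrite (parseval_poly pK) //; apply: eq_bigr => k _.
  by rewrite big_ord1 pE norm_conjC.
rewrite -gmeanZ; apply: (@le_trans _ _ (gmean (fun z => `|h z * (p.[z])^*| ^+ 2))).
  apply: le_trans (bessel _ (_ : (1 + L <= M)%N)) => //.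
  rewrite le_eqVlt; apply/orP; left; apply/eqP; apply: eq_bigr => j _.
  rewrite big_ord1 mxE; congr (`|_| ^+ 2).
  rewrite /fourier (@eq_gmean _ (fun z => h z * (z ^+ (1 + j))^* * (p.[z])^*)).
    rewrite (gmean_mul_poly_conj _ pK); apply: eq_bigr => k _.
    rewrite mxE pE conjCK mulrC; congr (_ * _); apply: eq_gmean => i.
    by rewrite exprD rmorphM /= mulrA.
  by move=> k; rewrite mulrAC.
by apply: gmean_le => k; rewrite normrM norm_conjC exprMn ler_wpM2r ?exprn_ge0 //.
Qed.

(** Kronecker's theorem, in the direction needed here.  The columns of [Z] are
    the shifts of the reversed denominator [q']; the Hankel matrix kills them
    because pairing [p / q] with them leaves Fourier coefficients of [p] of
    index greater than [n].  They are independent, because multiplication by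
    [q'] is injective on polynomials, so the rank is at most [K - (K - n)]. *)
Lemma rank_hankel_rational L K n (p q : {poly C}) :
    (size p <= n.+1)%N -> (size q <= n.+1)%N -> (L + K <= M)%N -> (n < K)%N ->
    (forall k, q.[c * w ^+ k] != 0) ->
  (\rank (hankel L K (fun z => p.[z] / q.[z])) <= n)%N.
Proof.
move=> pn qn LKM nK q0.
pose q' := \poly_(i < n.+1) q`_(n - i).
have q'0 : q' != 0.
  have : q != 0 by apply: contraNneq (q0 0%N) => ->; rewrite horner0.
  apply: contraNneq => q'0; apply/eqP/polyP => i; rewrite coef0.
  have [ni|ni] := ltnP n i; first by rewrite nth_default // (leq_trans qn).
  have : q'`_(n - i) = 0 by rewrite q'0 coef0.
  by rewrite coef_poly ltnS leq_subr subKn.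
have q'E z : `|z| = 1 -> q'.[z^*] = (z ^+ n)^* * q.[z].
  move=> z1; rewrite horner_poly (horner_coef_wide z qn) mulr_sumr.
  rewrite (reindex_inj rev_ord_inj) /=; apply: eq_bigr => i _.
  have zz : z^* * z = 1 by rewrite mulrC -normCK z1 expr1n.
  have le_in : (i <= n)%N by rewrite -ltnS.
  rewrite subSS subKn // mulrCA; congr (_ * _).
  have -> : z ^+ n = z ^+ (n - i) * z ^+ i by rewrite -exprD subnK.
  rewrite rmorphM /= !rmorphXn /=.
  by rewrite -mulrA -exprMn zz expr1n mulr1.
pose Z := \matrix_(k < K, t < K - n) (q' * 'X^t)`_k.
have rkZ : \rank Z = (K - n)%N.
  rewrite -mxrank_tr; apply/eqP; rewrite -/(row_free _) -kermx_eq0.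
  apply/eqP/row_matrixP => i; rewrite row0; set u := row i _.
  have uZ : u *m Z^T = 0 by apply/sub_kermxP; rewrite row_sub.
  suff U0 : rVpoly u = 0 by rewrite -[u]rVpolyK U0 linear0.
  apply: (mulfI q'0); rewrite mulr0; apply/polyP => k; rewrite coef0.
  have [kK|kK] := ltnP k K; last first.
    have q's : (size q' <= n.+1)%N by exact: size_poly.
    have Us : (size (rVpoly u) <= K - n)%N by exact: size_poly.
    rewrite nth_default // (leq_trans _ kK) // (leq_trans (size_polyMleq _ _)) //.
    by move: q's Us nK; move: (size q') (size (rVpoly u)) => ? ?; lia.
  have /rowP/(_ (Ordinal kK)) := uZ; rewrite !mxE => uZk; rewrite -[RHS]uZk.
  rewrite /rVpoly poly_def mulr_sumr coef_sum; apply: eq_bigr => t _.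
  by rewrite valK !mxE -scalerAr coefZ.
have HZ : hankel L K (fun z => p.[z] / q.[z]) *m Z = 0.
  apply/matrixP => j t; rewrite !mxE.
  have sX : (size (q' * 'X^t)%R <= K)%N.
    have q's : (size q' <= n.+1)%N by exact: size_poly.
    have := size_polyMleq q' 'X^t; rewrite size_polyXn.
    have := ltn_ord t; move: q's; move: (size q') (size _) => a b; lia.
  have jM : (j.+1 + t + n < M)%N by have := ltn_ord t; have := ltn_ord j; lia.
  transitivity (fourier (horner p) (j.+1 + t + n)); last first.
    rewrite fourier_poly ?nth_default ?(leq_trans pn) //; lia.
  transitivity (gmean (fun z =>
    p.[z] / q.[z] * (z ^+ j.+1)^* * ((map_poly Num.conj (q' * 'X^t)).[z])^*)).
    rewrite (@gmean_mul_poly_conj _ K); last by rewrite size_map_poly.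
    apply: eq_bigr => k _; rewrite !mxE coef_map /= conjCK mulrC; congr (_ * _).
    by apply: eq_gmean => i; rewrite exprD rmorphM /= mulrA.
  apply: eq_gmean => k; set z := c * _; have z1 : `|z| = 1 by exact: norm_node.
  have -> : ((map_poly Num.conj (q' * 'X^t)).[z])^* = (q' * 'X^t).[z^*].
    by rewrite -[in LHS](conjCK z) horner_map /= conjCK.
  have tE : ('X^t).[z^*] = (z ^+ t)^* by rewrite hornerXn rmorphXn.
  rewrite hornerM tE q'E // !exprD !rmorphM /=.
  have := q0 k; rewrite -/z.
  move: (z ^+ n)^* (z ^+ j.+1)^* (z ^+ t)^* q.[z] p.[z] => x1 x2 x3 x4 x5 x4_neq0.
  by field; exact: x4_neq0.
by have := mulmx0_rank_max HZ; rewrite rkZ; lia.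
Qed.

(** The coefficient [P`_m] occurs [minn m L] times in the [L]-row Hankel matrix
    of [P], provided that there are at least [size P] columns. *)
Lemma hankel_lower_bound L n S (P p q : {poly C}) :
    (size p <= n.+1)%N -> (size q <= n.+1)%N ->
    (L + (size P + n.+1) < M)%N ->
    (forall k, q.[c * w ^+ k] != 0) ->
    (forall k, `|P.[c * w ^+ k]| ^+ 2 <= S) ->
  \sum_(m < size P) (minn m L)%:R * `|P`_m| ^+ 2 - n%:R * S
    <= L%:R * gmean (fun z => `|P.[z] - p.[z] / q.[z]| ^+ 2).
Proof.
move=> pn qn LM q0 PS; pose K := (size P + n.+1)%N.
have LKM : (L + K <= M)%N by exact: ltnW.
have S0 : 0 <= S by rewrite (le_trans _ (PS 0%N)) ?exprn_ge0.
apply: le_trans (frob_hankel_le _ LKM); rewrite hankelB.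
apply: le_trans (frob_low_rank _ (_ : forall v, _ <= S * _)); last first.
  by move=> v; apply: frob_hankel_mul => //; lia.
rewrite lerB //; last first.
  rewrite ler_wpM2r // ler_nat; apply: rank_hankel_rational => //; lia.
rewrite le_eqVlt; apply/orP; left; apply/eqP.
transitivity (\sum_(j < L) \sum_(m < size P) (j < m)%:R * `|P`_m| ^+ 2).
  rewrite exchange_big /=; apply: eq_bigr => m _; rewrite -mulr_suml.
  congr (_ * _); rewrite -natr_sum; congr (_%:R).
  by elim: (L) => [|L' IH]; rewrite ?big_ord0 ?minn0 // big_ord_recr /= -IH; lia.
apply: eq_bigr => j _.
rewrite (@sum_ord_widen _ _ (j.+1 + K)%N (fun m => (j < m)%:R * `|P`_m| ^+ 2)); first last.
- by move=> m mP; rewrite nth_default // normr0 expr0n mulr0.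
- by rewrite /K; lia.
rewrite big_split_ord /= big1 ?add0r => [|i _]; last first.
  by rewrite ltnNge -ltnS ltn_ord mul0r.
apply: eq_bigr => k _; rewrite leq_addr mul1r mxE fourier_poly //; first lia.
by have := ltn_ord j; have := ltn_ord k; lia.
Qed.
End Grid.

(** * Dirichlet sums of polynomials *)

Section Dirichlet.
Variable C : numClosedFieldType.
Implicit Types (p h : {poly C}) (a : C).

Definition dirichlet p : C := \sum_(m < size p) m%:R * `|p`_m| ^+ 2.

Lemma dirichletE K p : (size p <= K)%N ->
  dirichlet p = \sum_(m < K) m%:R * `|p`_m| ^+ 2.
Proof.
move=> pK; rewrite /dirichlet.
rewrite (@sum_ord_widen _ (size p) K (fun m => m%:R * `|p`_m| ^+ 2)) // => m mp.
by rewrite nth_default // normr0 expr0n mulr0.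
Qed.

(** With [u = (1 - a^* X) h] and [g = (X - a) h], the cross terms of [|u_m|^2]
    and [|g_m|^2] have the same real part, so that
    [|g_m|^2 - |u_m|^2 = (1 - |a|^2) * (|h_(m-1)|^2 - |h_m|^2)].  Weighting by
    [m] and summing by parts leaves the sum of the [|h_k|^2]. *)
Lemma dirichlet_blaschke_factor a h K : (size h <= K)%N ->
  dirichlet (('X - a%:P) * h) = dirichlet ((1 - a^* *: 'X) * h)
    + (1 - `|a| ^+ 2) * \sum_(k < K) `|h`_k| ^+ 2.
Proof.
move=> hK.
have sz1 : (size ((1 - a^* *: 'X) * h)%R <= K.+1)%N.
  rewrite (leq_trans (size_polyMleq _ _)) //.
  have : (size (1 - a^* *: 'X)%R <= 2)%N.
    rewrite (leq_trans (size_polyD _ _)) // geq_max size_polyN size_poly1 /=.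
    by rewrite (leq_trans (size_scale_leq _ _)) ?size_polyX.
  by move: hK; move: (size h) (size _) => u v; lia.
have sz2 : (size (('X - a%:P) * h)%R <= K.+1)%N.
  rewrite (leq_trans (size_polyMleq _ _)) // size_XsubC.
  by move: hK; move: (size h) => u; lia.
rewrite (dirichletE sz1) (dirichletE sz2) !big_ord_recl !mul0r !add0r.
pose H k := `|h`_k| ^+ 2.
have HK : H K = 0 by rewrite /H nth_default // normr0 expr0n.
have coefE i : `|(('X - a%:P) * h)`_i.+1| ^+ 2 =
    `|((1 - a^* *: 'X) * h)`_i.+1| ^+ 2 + (1 - `|a| ^+ 2) * (H i - H i.+1).
  rewrite !mulrBl mul1r -scalerAl !coefB coefZ coefCM !coefXM /= /H.
  rewrite !normCK !rmorphB !rmorphM /= !conjCK; ring.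
rewrite (eq_bigr (fun i : 'I_K => i.+1%:R * `|((1 - a^* *: 'X) * h)`_i.+1| ^+ 2
    + (1 - `|a| ^+ 2) * (i.+1%:R * (H i - H i.+1)))) => [|i _]; last first.
  by rewrite lift0 coefE; ring.
rewrite big_split -mulr_sumr; congr (_ + _ * _).
suff -> : \sum_(i < K) i.+1%:R * (H i - H i.+1) = \sum_(i < K) H i - K%:R * H K.
  by rewrite HK mulr0 subr0.
elim: (K) => [|k IH]; first by rewrite !big_ord0 mul0r subr0.
by rewrite !big_ord_recr /= IH -natr1; ring.
Qed.

(** [p] and ['X^T * p] have disjoint supports. *)
Lemma dirichletB_shift p a T : (size p <= T)%N ->
  dirichlet p <= dirichlet (p - a *: ('X^T * p)).
Proof.
move=> pT.
have cf m : (p - a *: ('X^T * p))`_m = if (m < T)%N then p`_m else - a * p`_(m - T).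
  rewrite coefB coefZ coefXnM; case: ifP => mT; first by rewrite mulr0 subr0.
  by rewrite [p`_m]nth_default ?sub0r ?mulNr // (leq_trans pT) // leqNgt mT.
pose K := maxn T (size (p - a *: ('X^T * p))).
rewrite (dirichletE (leq_maxr _ _ : _ <= K)%N) (@dirichletE K p); last first.
  by rewrite (leq_trans pT) ?leq_maxl.
apply: ler_sum => m _; rewrite cf; case: ltnP => mT //.
by rewrite nth_default ?(leq_trans pT) // normr0 expr0n mulr0 mulr_ge0 ?exprn_ge0.
Qed.

Definition geom a T : {poly C} := \sum_(k < T) a ^+ k *: 'X^k.

Lemma geom_factor a T : (1 - a *: 'X) * geom a T = 1 - a ^+ T *: 'X^T.
Proof.
rewrite /geom (eq_bigr (fun k : 'I_T => (a *: 'X) ^+ k)); last first.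
  by move=> k _; rewrite exprZn.
by rewrite -[RHS]opprB -[_ *: 'X^T]exprZn subrX1 -mulNr opprB.
Qed.

Lemma coef_geom a T k : (geom a T)`_k = if (k < T)%N then a ^+ k else 0.
Proof.
rewrite /geom -(poly_def T (fun k => a ^+ k)) coef_poly //.
Qed.

(** The polynomial [('X - a) * geom a^* T] is the Blaschke factor
    [(z - a) / (1 - a^* z)] with its geometric series truncated.  If [|p|] is
    almost [1] on the circle, then [m] can be taken close to [1], and this
    factor raises the Dirichlet sum by almost [1].  The condition
    [size p <= T] is what makes [dirichletB_shift] applicable. *)
Lemma dirichlet_step p a T m M (w : C) : M.-primitive_root w ->
    (size p <= T)%N -> (size (geom a^* T * p)%R <= M)%N -> (T <= M)%N ->
    `|a| < 1 -> 0 <= m -> (forall z, `|z| = 1 -> m <= `|p.[z]| ^+ 2) ->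
  dirichlet p + m * (1 - `|a| ^+ T ^+ 2)
    <= dirichlet (('X - a%:P) * (geom a^* T * p)).
Proof.
move=> pw pT hM TM a1 m0 pm; set h := geom _ _ * p.
rewrite (dirichlet_blaschke_factor _ (leqnn (size h))) lerD //.
  rewrite mulrA geom_factor mulrBl mul1r -scalerAl; exact: dirichletB_shift.
have n1 : `|1| = 1 :> C by exact: normr1.
rewrite -(parseval_poly pw n1 (leqnn (size h)) hM).
have gT : (size (geom a^* T) <= T)%N.
  by apply/leq_sizeP => j Tj; rewrite coef_geom ltnNge Tj.
apply: (@le_trans _ _ ((1 - `|a| ^+ 2) *
    gmean M w 1 (fun z => m * `|(geom a^* T).[z]| ^+ 2))); last first.
  have a2 : 0 <= 1 - `|a| ^+ 2 by rewrite subr_ge0 exprn_ile1 // ltW.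
  rewrite ler_wpM2l //; apply: gmean_le => k.
  rewrite hornerM normrM exprMn mulrC ler_wpM2l ?exprn_ge0 //.
  by apply: pm; exact: norm_node pw n1 k.
rewrite gmeanZ (parseval_poly pw n1 gT TM) mulrCA ler_wpM2l //.
rewrite (eq_bigr (fun k : 'I_T => (`|a| ^+ 2) ^+ k)) => [|k _]; last first.
  by rewrite coef_geom ltn_ord normrX norm_conjC -!exprM mulnC.
rewrite -[X in X * _]opprB [leRHS]mulNr -subrX1 opprB.
by rewrite -!exprM mulnC.
Qed.

End Dirichlet.

Local Open Scope complex_scope.

(** * Roots of unity and moduli in [R[i]] *)

Section UnitCircle.
Variable R : realType.
Implicit Types (t : R) (z a : R[i]).

Lemma cisD t1 t2 : cis (t1 + t2) = cis t1 * cis t2.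
Proof. by rewrite /cis cosD sinD; simpc; congr (_ +i* _); rewrite addrC. Qed.

Lemma cis0 : cis (0 : R) = 1.
Proof. by rewrite /cis cos0 sin0. Qed.

Lemma cisMn t k : cis (t * k%:R) = cis t ^+ k.
Proof.
elim: k => [|k IH]; first by rewrite mulr0 cis0.
by rewrite -natr1 mulrDr mulr1 cisD IH exprSr.
Qed.

Lemma norm_cis t : `|cis t| = 1.
Proof. by rewrite /cis normc_def /= cos2Dsin2 sqrtr1. Qed.

Lemma cis_eq1 t : 0 < t < 2 * pi -> cis t != 1.
Proof.
move=> /andP[t0 t2]; apply/eqP => -[c1 _].
have s0 : 0 < sin (t / 2) by apply: sin_gt0_pi; lra.
have : cos (t / 2 + t / 2) = 1 by rewrite -splitr.
rewrite cosD -!expr2 => c2; have := cos2Dsin2 (t / 2); nra.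
Qed.

Definition prim_cis (M : nat) : R[i] := cis (2 * pi / M%:R).

Lemma prim_cisP M : (0 < M)%N -> M.-primitive_root (prim_cis M).
Proof.
move=> M0; have MR0 : 0 < M%:R :> R by rewrite ltr0n.
have uM : prim_cis M ^+ M = 1.
  by rewrite -cisMn divfK ?gt_eqF // /cis mulr_natl cos2pi sin2pi.
have [m pm dm] := prim_order_exists M0 uM.
have m0 := prim_order_gt0 pm.
have [mM|Mm] := ltnP m M; last first.
  have mM : m = M by apply/eqP; rewrite eqn_leq Mm dvdn_leq.
  by rewrite mM in pm.
have /eqP : prim_cis M ^+ m = 1 by exact: prim_expr_order.
rewrite -cisMn; apply: contraTT => _; apply: cis_eq1.
have pi0 := pi_gt0 R; rewrite !mulr_gt0 ?ltr0n ?invr_gt0 //=.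
by rewrite mulrAC ltr_pdivrMr // ltr_pM2l ?mulr_gt0 // ltr_nat.
Qed.

Lemma sqr_normc z : `|z| ^+ 2 = (normc z ^+ 2)%:C.
Proof. by rewrite rmorphXn. Qed.

Lemma normc_eq1 z : (normc z == 1) = (`|z| == 1).
Proof. by rewrite -(inj_eq (@complexI R)). Qed.

Lemma normc_cis t : normc (cis t) = 1.
Proof. by apply/eqP; rewrite normc_eq1 norm_cis. Qed.

Lemma normcD z1 z2 : normc (z1 + z2) <= normc z1 + normc z2.
Proof. exact: le_normcD. Qed.

Lemma normc_ge0 z : 0 <= normc z.
Proof. by have := normr_ge0 z; rewrite lecR. Qed.

Lemma normcX z k : normc (z ^+ k) = normc z ^+ k.
Proof. by apply: (@complexI R); rewrite -[LHS]/`|z ^+ k| normrX rmorphXn. Qed.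

Lemma normcC z : normc z^* = normc z.
Proof. apply: (@complexI R); exact: (norm_conjC z). Qed.

Definition grid_mean (M : nat) (t : R) (h : R[i] -> R) : R :=
  M%:R^-1 * \sum_(k < M) h (cis (t + 2 * pi / M%:R * k%:R)).

Lemma gmean_grid_mean M t h :
  gmean M (prim_cis M) (cis t) (fun z => (h z)%:C) = (grid_mean M t h)%:C.
Proof.
rewrite /gmean /grid_mean rmorphM fmorphV rmorph_nat rmorph_sum; congr (_ * _).
by apply: eq_bigr => k _; rewrite -cisMn -cisD.
Qed.

End UnitCircle.

(** * Polynomial approximation of Blaschke products *)

Section BlaschkeApprox.
Variable R : realType.
Implicit Types (z a : R[i]) (P : {poly R[i]}) (zs : seq R[i]).

(** The value of [dirichlet P] as an element of [R]. *)
Definition dirichletR P : R := \sum_(m < size P) m%:R * normc P`_m ^+ 2.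

Lemma dirichletRE P : (dirichletR P)%:C = dirichlet P.
Proof.
rewrite /dirichletR rmorph_sum; apply: eq_bigr => m _.
by rewrite rmorphM rmorph_nat rmorphXn.
Qed.

Definition blaschke zs z : R[i] := \prod_(a <- zs) ((z - a) / (1 - a^* * z)).

Lemma blaschke_cons a zs z :
  blaschke (a :: zs) z = (z - a) / (1 - a^* * z) * blaschke zs z.
Proof. exact: big_cons. Qed.

Lemma expr_small (x e : R) (k : nat) : 0 <= x < 1 -> 0 < e ->
  exists2 T, (k <= T)%N & x ^+ T <= e.
Proof.
move=> /andP[x0 x1] e0.
have /cvgrPdist_le/(_ e e0) cx : x ^+ T @[T --> \oo] --> 0.
  by apply: cvg_expr; rewrite ger0_norm.
near \oo => T; exists T; first by near: T; exact: nbhs_infty_ge.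
have : `|0 - x ^+ T| <= e by near: T; exact: cx.
by rewrite sub0r normrN ger0_norm // exprn_ge0.
Unshelve. all: by end_near. Qed.

Lemma denom_neq0 a z : normc a * normc z < 1 -> 1 - a^* * z != 0.
Proof.
move=> az; rewrite subr_eq0 eq_sym; apply: contraTneq az => /(congr1 (@Normc.normc R)).
by rewrite Normc.normcM normcC Normc.normc1 => ->; rewrite ltxx.
Qed.

Lemma normc_blaschke zs z : (forall a, a \in zs -> normc a < 1) -> normc z = 1 ->
  normc (blaschke zs z) = 1.
Proof.
move=> zs1 z1; rewrite /blaschke big_seq.
elim/big_rec: _ => [|a x /zs1 a1 IH]; first exact: Normc.normc1.
have d0 : 1 - a^* * z != 0 by rewrite denom_neq0 // z1 mulr1.
rewrite Normc.normcM IH mulr1 Normc.normcM Normc.normcV.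
suff -> : normc (z - a) = normc (1 - a^* * z).
  by rewrite divff //; apply: contra_neq d0 => /Normc.eq0_normc.
have zz : z * z^* = 1.
  by have := sqr_normc z; rewrite z1 expr1n normCK.
have -> : 1 - a^* * z = z * (z - a)^*.
  by rewrite rmorphB /= mulrBr zz [a^* * z]mulrC.
by rewrite Normc.normcM normcC z1 mul1r.
Qed.

Lemma real_dirichlet_step P a T (m : R) : (size P <= T)%N -> normc a < 1 -> 0 <= m ->
    (forall z, normc z = 1 -> m <= normc P.[z] ^+ 2) ->
  dirichletR P + m * (1 - normc a ^+ T ^+ 2)
    <= dirichletR (('X - a%:P) * (geom a^* T * P)).
Proof.
move=> PT a1 m0 Pm; rewrite -lecR rmorphD rmorphM rmorphB rmorph1 !rmorphXn /=.
rewrite !dirichletRE.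
pose M := (maxn (size (geom a^* T * P)%R) T).+1.
apply: (@dirichlet_step _ P a T m%:C M _ (@prim_cisP R M isT)) => //.
- by rewrite ltnW // ltnS leq_maxl.
- by rewrite ltnW // ltnS leq_maxr.
- by rewrite ltcR.
- by rewrite lecR.
- move=> z z1; rewrite sqr_normc lecR; apply: Pm.
  by apply/eqP; rewrite normc_eq1 z1.
Qed.

(** Induction on the zeros, one truncated factor at a time.  The relative form
    of the error is preserved by multiplication by a Blaschke factor, so no
    bound on the product itself is needed; the truncation error is governed by
    [(l * s) ^+ T]. *)
Lemma blaschke_poly_approx (l s : R) zs : 0 <= l -> 1 <= s -> l * s < 1 ->
    (forall a, a \in zs -> normc a <= l) ->
  forall e : R, 0 < e <= 1 -> exists P : {poly R[i]},
    (forall z, 1 <= normc z <= s ->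
      normc (P.[z] - blaschke zs z) <= e * normc (blaschke zs z))
    /\ (size zs)%:R - e <= dirichletR P.
Proof.
move=> l0 s1 ls; elim: zs => [|a zs IH] zsl e /andP[e0 e1].
  exists 1; split => [z _|].
    by rewrite hornerE /blaschke big_nil subrr Normc.normc0 Normc.normc1 mulr1 ltW.
  rewrite /dirichletR size_poly1 big_ord1 mul0r sub0r oppr_le0 ltW //.
have al : normc a <= l by apply: zsl; rewrite mem_head.
have zsl' b : b \in zs -> normc b <= l by move=> bz; apply: zsl; rewrite inE bz orbT.
have l1 : l < 1 by rewrite (le_lt_trans _ ls) // ler_peMr.
have e4 : 0 < e / 4 <= 1 by lra.
have [P [PB PD]] := IH zsl' _ e4.
have [||T PT Te] := @expr_small (l * s) (e / 4) (size P).
- by rewrite ls mulr_ge0 //; lra.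
- by lra.
(* Each of the three sources of error, the approximation [P] of the shorter
   product, the truncation, and [|P|^2] being less than [1], costs at most a
   multiple of [e / 4]. *)
exists (('X - a%:P) * (geom a^* T * P)); split.
  move=> z /andP[z1 zs']; rewrite blaschke_cons.
  have az : normc a * normc z <= l * s by rewrite ler_pM // normc_ge0.
  have d0 : 1 - a^* * z != 0 by rewrite denom_neq0 // (le_lt_trans az).
  set b := (z - a) / _; set B := blaschke zs z.
  have -> : (('X - a%:P) * (geom a^* T * P)).[z] - b * B =
      b * ((P.[z] - B) - (a^* * z) ^+ T * P.[z]).
    have := congr1 (horner^~ z) (@geom_factor _ a^* T).
    rewrite !hornerE /= => gE.
    have -> : (geom a^* T).[z] = (1 - (a^* * z) ^+ T) / (1 - a^* * z).
      by rewrite exprMn -gE mulrAC divff // mul1r.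
    rewrite /b; move: (_ ^+ T) => y; field; exact: d0.
  rewrite !(Normc.normcM b) mulrCA ler_wpM2l ?normc_ge0 //.
  have PB1 := PB z; rewrite z1 zs' in PB1; have {}PB1 := PB1 isT.
  have PBn : normc P.[z] <= (1 + e / 4) * normc B.
    have := normcD (P.[z] - B) B; rewrite subrK => /le_trans -> //; lra.
  have yT : normc ((a^* * z) ^+ T) <= e / 4.
    rewrite normcX Normc.normcM normcC (le_trans _ Te) // lerXn2r //.
      by rewrite nnegrE mulr_ge0 ?normc_ge0.
    by rewrite nnegrE mulr_ge0 //; lra.
  rewrite (le_trans (normcD _ _)) // normcN Normc.normcM.
  have B0 := normc_ge0 B.
  apply: (@le_trans _ _ (e / 4 * normc B + e / 4 * ((1 + e / 4) * normc B))).
    by rewrite lerD // ler_pM ?normc_ge0.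
  by rewrite mulrA -mulrDl ler_wpM2r //; nra.
apply: le_trans (real_dirichlet_step PT _ (_ : 0 <= (1 - e / 4) ^+ 2) _).
- have aT : normc a ^+ T <= e / 4.
    rewrite (le_trans _ Te) // lerXn2r ?nnegrE ?normc_ge0 ?mulr_ge0 //; first lra.
    by rewrite (le_trans al) // ler_peMr.
  have aT0 : 0 <= normc a ^+ T by rewrite exprn_ge0 ?normc_ge0.
  rewrite /= -natr1; nra.
- by rewrite (le_lt_trans al).
- by rewrite sqr_ge0.
- move=> z z1.
  have B1 : normc (blaschke zs z) = 1.
    by apply: normc_blaschke => // b /zsl' bl; rewrite (le_lt_trans bl).
  have := PB z; rewrite z1 lexx s1 B1 mulr1 => /(_ isT) PB1.
  have := normcD P.[z] (blaschke zs z - P.[z]); rewrite addrC subrK B1.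
  rewrite -[X in _ + normc X]opprB normcN => n1.
  by rewrite lerXn2r ?nnegrE ?normc_ge0 //; lra.
Qed.

End BlaschkeApprox.

(** * The lower bound on one grid *)

Section CoreBound.
Variable R : realType.
Implicit Types (z a : R[i]) (P p q : {poly R[i]}) (zs : seq R[i]).

Lemma normc_sqrE z : normc z ^+ 2 = complex.Re z ^+ 2 + complex.Im z ^+ 2.
Proof. by case: z => x y /=; rewrite sqr_sqrtr // addr_ge0 ?sqr_ge0. Qed.

(** Parseval's identity for the polynomial [Q], with [Q.[z] = P.[s * z]]. *)
Lemma parseval_circle_le P (s S : R) : 0 <= s ->
    (forall z, normc z = s -> normc P.[z] ^+ 2 <= S) ->
  \sum_(m < size P) normc P`_m ^+ 2 * s ^+ (2 * m) <= S.
Proof.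
move=> s0 PS; pose Q := \poly_(m < size P) (P`_m * s%:C ^+ m).
have QE z : Q.[z] = P.[s%:C * z].
  rewrite horner_poly horner_coef; apply: eq_bigr => m _.
  by rewrite exprMn mulrA.
have szQ : (size Q <= size P)%N by exact: size_poly.
have prim_w := @prim_cisP R (size P).+1 isT.
have := parseval_poly prim_w (normr1 R[i]) szQ (leqnSn _).
have -> : \sum_(m < size P) `|Q`_m| ^+ 2 =
    (\sum_(m < size P) normc P`_m ^+ 2 * s ^+ (2 * m))%:C.
  rewrite rmorph_sum; apply: eq_bigr => m _; rewrite coef_poly ltn_ord sqr_normc.
  congr (_%:C); rewrite Normc.normcM exprMn normcX mulnC exprM; congr (_ * _ ^+ _ ^+ _).
  by rewrite /= expr0n addr0 sqrtr_sqr ger0_norm.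
move=> pE; rewrite -lecR -pE.
apply: (gmean_le_bound prim_w) => k; rewrite QE sqr_normc lecR; apply: PS.
have := norm_node prim_w (normr1 R[i]) k => /eqP; rewrite -normc_eq1 => /eqP n1.
by rewrite Normc.normcM n1 mulr1 /= expr0n addr0 sqrtr_sqr ger0_norm.
Qed.

(** The difference is the sum of [(m - L) * |P_m|^2] over [m > L].  By
    Bernoulli's inequality [(m - L) * (s^2 - 1) <= s^(2 (m - L))], it is
    controlled by the sum of the [|P_m|^2 * s^(2 m)]. *)
Lemma truncated_dirichlet_ge P L (s S : R) : 1 < s ->
    (forall z, normc z = s -> normc P.[z] ^+ 2 <= S) ->
  dirichletR P - S / (s ^+ (2 * L) * (s ^+ 2 - 1))
    <= \sum_(m < size P) (minn m L)%:R * normc P`_m ^+ 2.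
Proof.
move=> s1 PS; have s0 : 0 <= s by lra.
have s21 : 0 < s ^+ 2 - 1 by nra.
have sL : 0 < s ^+ (2 * L) by rewrite exprn_gt0; lra.
rewrite lerBlDr -lerBlDl /dirichletR -sumrB ler_pdivlMr ?mulr_gt0 //.
apply: le_trans (parseval_circle_le s0 PS); rewrite mulr_suml.
apply: ler_sum => m _; rewrite -mulrBl mulrAC mulrC ler_wpM2l ?sqr_ge0 //.
have [mL|Lm] := leqP m L.
  by rewrite subrr mul0r exprn_ge0.
rewrite -natrB ?(ltnW Lm) //.
have bern k : k%:R * (s ^+ 2 - 1) <= s ^+ (2 * k).
  elim: k => [|k IH]; first by rewrite mul0r ler01.
  rewrite mulnS exprD -natr1; have : 1 <= s ^+ (2 * k) by rewrite exprn_ege1 // ltW.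
  nra.
have -> : s ^+ (2 * m) = s ^+ (2 * L) * s ^+ (2 * (m - L)).
  by rewrite -exprD -mulnDr subnKC // ltnW.
by rewrite mulrCA ler_wpM2l ?(ltW sL).
Qed.

(** For fixed [|a|] and [|z| = s > 1] the modulus is largest when [a^* z] is
    positive, and it then increases with [|a|]. *)
Lemma normc_blaschke_factor_le a z (l s : R) : 0 <= l -> normc a <= l -> 1 < s ->
  l * s < 1 -> normc z = s ->
  normc ((z - a) / (1 - a^* * z)) <= (s - l) / (1 - l * s).
Proof.
move=> l0 al s1 ls zs.
have l1 : l < 1 by nra.
have az : normc a * normc z < 1 by rewrite zs; have := normc_ge0 a; nra.
have dn0 := denom_neq0 az.
have dn : 0 < normc (1 - a^* * z).
  by rewrite lt_def normc_ge0 andbT; apply: contra_neq dn0 => /Normc.eq0_normc.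
rewrite Normc.normcM Normc.normcV ler_pdivrMr // mulrAC ler_pdivlMr; last lra.
have : (normc (z - a) * (1 - l * s)) ^+ 2 <= ((s - l) * normc (1 - a^* * z)) ^+ 2.
  rewrite !exprMn !normc_sqrE.
  have : normc z ^+ 2 = s ^+ 2 by rewrite zs.
  have r0 := normc_ge0 a; move: (normc a) al r0 (normc_sqrE a) => r rl r0.
  rewrite normc_sqrE; case: z a {az dn dn0 zs} => [x y] [u v] /= r2 s2.
  (* [Y] is the real part of [a^* z]. *)
  pose Y := u * x + v * y.
  have Yrs : Y <= r * s.
    have Y2 : Y ^+ 2 <= (r * s) ^+ 2.
      rewrite exprMn r2 -s2 -subr_ge0.
      have -> : (u ^+ 2 + v ^+ 2) * (x ^+ 2 + y ^+ 2) - Y ^+ 2 = (u * y - v * x) ^+ 2.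
        by rewrite /Y; ring.
      exact: sqr_ge0.
    have rs0 : 0 <= r * s by rewrite mulr_ge0 //; lra.
    by rewrite (le_trans (ler_norm _)) // -(ger0_norm rs0) -ler_sqr ?nnegrE // !real_normK ?num_real.
  have -> : (x - u) ^+ 2 + (y - v) ^+ 2 = s ^+ 2 - 2 * Y + r ^+ 2.
    by rewrite r2 -s2 /Y; ring.
  set d2 := (X in _ <= _ * X).
  have -> : d2 = 1 - 2 * Y + r ^+ 2 * s ^+ 2 by rewrite /d2 r2 -s2 /Y; ring.
  have d2ge : (1 - r * s) ^+ 2 <= 1 - 2 * Y + r ^+ 2 * s ^+ 2 by lra.
  (* Both moduli are affine in [Y]; the difference of the two sides is
     [s ^+ 2 - 1] times the quantity below. *)
  have key : 0 <= (1 - l ^+ 2) * (1 - 2 * Y + r ^+ 2 * s ^+ 2)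
                   - (1 - l * s) ^+ 2 * (1 - r ^+ 2).
    apply: (@le_trans _ _ ((l - r) * ((s - l) * (1 - s * r) + (s - r) * (1 - s * l)))).
      have sr : 0 <= 1 - s * r by nra.
      have sr' : 0 <= s - r by lra.
      have sl' : 0 <= s - l by lra.
      have sl : 0 <= 1 - s * l by lra.
      have lr : 0 <= l - r by rewrite subr_ge0.
      by apply: mulr_ge0 => //; apply: addr_ge0; apply: mulr_ge0.
    have l2 : 0 <= 1 - l ^+ 2 by nra.
    have := ler_wpM2l l2 d2ge; lra.
  have s21 : 0 <= s ^+ 2 - 1 by nra.
  by have := mulr_ge0 s21 key; lra.
rewrite ler_sqr ?nnegrE ?mulr_ge0 ?normc_ge0 //; lra.
Qed.

Lemma normc_blaschke_le zs z (l s : R) : 0 <= l -> 1 < s -> l * s < 1 ->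
    (forall a, a \in zs -> normc a <= l) -> normc z = s ->
  normc (blaschke zs z) <= ((s - l) / (1 - l * s)) ^+ size zs.
Proof.
move=> l0 s1 ls + z_s; elim: zs => [|a zs IH] zsl.
  by rewrite /blaschke big_nil Normc.normc1.
rewrite blaschke_cons Normc.normcM exprS ler_pM ?normc_ge0 //.
  by apply: normc_blaschke_factor_le => //; apply: zsl; rewrite mem_head.
by apply: IH => b bz; apply: zsl; rewrite inE bz orbT.
Qed.

Lemma real_hankel_lower_bound (L n M : nat) (t S : R) P p q :
    (size p <= n.+1)%N -> (size q <= n.+1)%N ->
    (L + (size P + n.+1) < M)%N ->
    (forall z, normc z = 1 -> q.[z] != 0) ->
    (forall z, normc z = 1 -> normc P.[z] ^+ 2 <= S) ->
  \sum_(m < size P) (minn m L)%:R * normc P`_m ^+ 2 - n%:R * S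
    <= L%:R * grid_mean M t (fun z => normc (P.[z] - p.[z] / q.[z]) ^+ 2).
Proof.
move=> pn qn LM q0 PS; have M0 : (0 < M)%N by exact: leq_ltn_trans LM.
have prim_w := @prim_cisP R M M0.
have node1 k : normc (cis t * prim_cis R M ^+ k) = 1.
  by apply/eqP; rewrite normc_eq1 (norm_node prim_w) ?norm_cis.
have := @hankel_lower_bound _ M _ (cis t) prim_w (norm_cis t) L n S%:C P p q pn qn LM.
move=> /(_ (fun k => q0 _ (node1 k))) H.
set h := (X in grid_mean M t X); have := gmean_grid_mean M t h.
move: (grid_mean M t h) => G hG.
rewrite -lecR rmorphB rmorph_sum !rmorphM !rmorph_nat /= -hG.
rewrite (eq_bigr (fun m : 'I_(size P) => (minn m L)%:R * `|P`_m| ^+ 2)); last first.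
  by move=> m _; rewrite sqr_normc rmorphM rmorph_nat.
rewrite (@eq_gmean _ _ _ _ _ (fun z => `|P.[z] - p.[z] / q.[z]| ^+ 2)); last first.
  by move=> k; rewrite sqr_normc.
by apply: H => k; rewrite sqr_normc lecR PS.
Qed.

Lemma grid_mean_ge (M : nat) (t : R) (h1 h2 : R[i] -> R) :
  (forall z, normc z = 1 -> h1 z <= h2 z) -> grid_mean M t h1 <= grid_mean M t h2.
Proof.
move=> h12; rewrite ler_wpM2l ?invr_ge0 // ler_sum // => k _.
by apply: h12; rewrite normc_cis.
Qed.

Lemma grid_mean_affine (M : nat) (t u v : R) (h : R[i] -> R) : (0 < M)%N ->
  grid_mean M t (fun z => u * h z + v) = u * grid_mean M t h + v.
Proof.
move=> M0; rewrite /grid_mean big_split /= -mulr_sumr sumr_const card_ord.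
by rewrite mulrDr mulrCA -[v *+ M]mulr_natl mulKf // pnatr_eq0 -lt0n.
Qed.

(** The grid [M] depends on [e], through the degree of the approximating
    polynomial, but the bound does not depend on the rotation [t].  The factor
    [1 + e] and the term [e + e ^+ 2] come from replacing the Blaschke product
    by a polynomial at distance at most [e] on the circle: if [g <= h + e] then
    [g^2 <= (1 + e) h^2 + e + e^2]. *)
Lemma blaschke_grid_bound (l s e : R) zs (L n : nat) p q :
    0 <= l -> 1 < s -> l * s < 1 -> (forall a, a \in zs -> normc a <= l) ->
    (size p <= n.+1)%N -> (size q <= n.+1)%N ->
    (forall z, normc z = 1 -> q.[z] != 0) -> 0 < e <= 1 ->
  let tau := ((s - l) / (1 - l * s)) ^+ (2 * size zs)
               / (s ^+ (2 * L) * (s ^+ 2 - 1)) in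
  exists2 M, (0 < M)%N & forall t,
    (size zs)%:R - e - (n%:R + tau) * (1 + e) ^+ 2 <=
    L%:R * ((1 + e)
      * grid_mean M t (fun z => normc (blaschke zs z - p.[z] / q.[z]) ^+ 2)
      + (e + e ^+ 2)).
Proof.
move=> l0 s1 ls zsl pn qn q0 /andP[e0 e1] tau.
have l1 : l < 1 by nra.
have e01 : 0 < e <= 1 by rewrite e0.
have [P [PB PD]] := blaschke_poly_approx l0 (ltW s1) ls zsl e01.
pose B := blaschke zs; pose k := (s - l) / (1 - l * s).
have k0 : 0 <= k by rewrite divr_ge0 //; lra.
have PBn z : 1 <= normc z <= s -> normc P.[z] <= (1 + e) * normc (B z).
  move=> /PB PBz; have := normcD (P.[z] - B z) (B z); rewrite subrK.
  by move=> /le_trans -> //; rewrite -/(B z) in PBz; lra.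
have B1 z : normc z = 1 -> normc (B z) = 1.
  by apply: normc_blaschke => b /zsl bl; rewrite (le_lt_trans bl).
exists (L + (size P + n.+1)).+1 => // t.
have P1 z : normc z = 1 -> normc P.[z] ^+ 2 <= (1 + e) ^+ 2.
  move=> z1; rewrite ler_sqr ?nnegrE ?normc_ge0 //; last lra.
  by have := PBn z; rewrite B1 // mulr1; apply; rewrite z1 lexx ltW.
have Ps z : normc z = s -> normc P.[z] ^+ 2 <= (1 + e) ^+ 2 * k ^+ (2 * size zs).
  move=> z_s; rewrite mulnC exprM -exprMn.
  have Bs : normc (B z) <= k ^+ size zs by exact: normc_blaschke_le.
  rewrite ler_sqr ?nnegrE ?normc_ge0 ?mulr_ge0 ?exprn_ge0 //; last lra.
  have z1s : 1 <= normc z <= s by rewrite z_s lexx (ltW s1).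
  by rewrite (le_trans (PBn z z1s)) // ler_wpM2l //; lra.
have T2 := real_hankel_lower_bound t pn qn (ltnSn (L + (size P + n.+1))) q0 P1.
have := truncated_dirichlet_ge L s1 Ps.
have -> : (1 + e) ^+ 2 * k ^+ (2 * size zs) / (s ^+ (2 * L) * (s ^+ 2 - 1)) =
    (1 + e) ^+ 2 * tau by rewrite /tau mulrA.
move=> T1; apply: le_trans (le_trans T2 _); first by lra.
rewrite ler_wpM2l // -grid_mean_affine //; apply: grid_mean_ge => z z1.
have PBz : normc (P.[z] - B z) <= e.
  by have := PB z; rewrite -/(B z) B1 // mulr1; apply; rewrite z1 lexx ltW.
have := normcD (P.[z] - B z) (B z - p.[z] / q.[z]); rewrite addrA subrK -/B.
move: PBz (normc_ge0 (P.[z] - p.[z] / q.[z])) (normc_ge0 (B z - p.[z] / q.[z])).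
move: (normc (P.[z] - B z)) (normc (P.[z] - p.[z] / q.[z]))
  (normc (B z - p.[z] / q.[z])) => d g h de g0 h0 gdh.
have ge : g ^+ 2 <= (e + h) ^+ 2 by rewrite ler_sqr ?nnegrE; lra.
have := mulr_ge0 (ltW e0) (sqr_ge0 (h - 1)); nra.
Qed.

End CoreBound.

(** * From grids to integrals *)

Section Averaging.
Variable R : realType.

(** With [F] a primitive of [h], the sum [G] of the [F (x + k T / M)] over
    [k < M] has derivative at least [B *+ M], while its increment from [0] to
    [T / M] telescopes to [F T - F 0].  So the mean value theorem gives the
    bound exactly, without any error of Riemann sums. *)
Lemma integral_ge_grid_sums (h : R -> R) (M : nat) (T B : R) :
    continuous h -> (0 < M)%N -> 0 < T ->
    (forall x, B *+ M <= \sum_(k < M) h (x + T / M%:R * k%:R)) ->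
  ((T * B)%:E <= \int[lebesgue_measure]_(t in `[0%R, T]) (h t)%:E)%E.
Proof.
move=> ch M0 T0 hB.
(* The base point [-1] lies to the left of [0], so that [F] is differentiable
   at [0] as well. *)
pose F (x : R) : R := (\int[lebesgue_measure]_(t in `[(-1)%R, x]) h t)%R.
have FE (x : R) : -1 < x -> derivable F x 1 /\ derive1 F x = h x.
  move=> x1; apply: (@continuous_FTC1_closed _ h (-1) x (x + 1)) => //.
  - by rewrite ltrDl.
  - apply: continuous_compact_integrable; first exact: segment_compact.
    exact: continuous_subspaceT.
  - exact: ch.
have F' (x : R) : -1 < x -> is_derive x (1:R) F (h x).
  by move=> /FE[dF <-]; rewrite derive1E; apply: DeriveDef.
have cF x : -1 < x -> {for x, continuous F}.
  move=> /FE[dF _]; apply: differentiable_continuous; exact/derivable1_diffP.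
have M0' : 0 < M%:R :> R by rewrite ltr0n.
have TM0 : 0 < T / M%:R by rewrite divr_gt0.
rewrite (@continuous_FTC2 _ h F) //; first last.
- by move=> x; rewrite in_itv /= => /andP[x0 _]; have [] := FE x (lt_trans (ltrN10 _) x0).
- split => [x||]; rewrite ?in_itv /=.
  + by move=> /andP[x0 _]; have [] := FE x (lt_trans (ltrN10 _) x0).
  + by apply: cvg_at_right_filter; apply: cF; rewrite ltrN10.
  + by apply: cvg_at_left_filter; apply: cF; rewrite (lt_trans (ltrN10 _)).
- exact: continuous_subspaceT.
pose G x := \sum_(k < M) F (x + T / M%:R * k%:R).
have tk0 (k : 'I_M) : 0 <= T / M%:R * k%:R by rewrite mulr_ge0 // ltW.
have G' (x : R) : -1 < x -> is_derive x (1:R) G (\sum_(k < M) h (x + T / M%:R * k%:R)).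
  move=> x0; rewrite /G.
  have -> : (fun x : R => \sum_(k < M) F (x + T / M%:R * k%:R)) =
      \sum_(k < M) (fun x : R => F (x + T / M%:R * k%:R)).
    by apply/funext => y; rewrite fct_sumE.
  suff dk (k : 'I_M) : is_derive x (1:R) (fun y => F (y + T / M%:R * k%:R))
      (h (x + T / M%:R * k%:R)) by exact: is_derive_sum.
  have Fk : is_derive (x + T / M%:R * k%:R) (1:R) F (h (x + T / M%:R * k%:R)).
    by apply: F'; have := tk0 k; lra.
  have sh : is_derive x (1:R) (fun y => y + T / M%:R * k%:R) 1.
    by rewrite -[X in is_derive _ _ _ X]addr0; exact: (@is_deriveD _ _ _ id (cst _)).
  have := @is_derive1_comp _ F (fun y : R => y + T / M%:R * k%:R) x _ _ Fk sh.
  by rewrite mulr1.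
have [x||c _ Gc] := @MVT R G (fun x => \sum_(k < M) h (x + T / M%:R * k%:R)) 0 _ TM0.
- by rewrite in_itv /= => /andP[x0 _]; apply: G'; rewrite (lt_trans _ x0).
- apply: derivable_within_continuous => x; rewrite in_itv /= => /andP[x0 _].
  have gx : -1 < x by rewrite (lt_le_trans _ x0).
  by have [] := G' x gx.
have GE : G (T / M%:R) - G 0 = F T - F 0.
  rewrite /G -sumrB (eq_bigr (fun k : 'I_M =>
      F (T / M%:R * k.+1%:R) - F (T / M%:R * k%:R))) => [|k _].
    rewrite -(big_mkord xpredT (fun k => F (T / M%:R * k.+1%:R) - F (T / M%:R * k%:R))).
    rewrite telescope_sumr // mulr0 divfK // ?gt_eqF //.
  by rewrite add0r -(@natr1 _ k) mulrDr mulr1 [_ / _ + _]addrC.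
rewrite -EFinD lee_fin -GE Gc subr0.
by rewrite [leRHS]mulrCA (ler_wpM2l (ltW T0)) // ler_pdivlMr // mulr_natr.
Qed.
End Averaging.

(** * Continuity along the unit circle *)

Section ComplexContinuity.
Variable R : realType.
Implicit Types g h : R -> R[i].

(** Continuity of both components; it serves only to make the squared modulus
    continuous. *)
Definition ccontinuous g :=
  continuous (fun t => complex.Re (g t)) /\ continuous (fun t => complex.Im (g t)).

Lemma ccontinuous_cst (c : R[i]) : ccontinuous (fun=> c).
Proof. by split; exact: cst_continuous. Qed.

Lemma ccontinuous_cis : ccontinuous (@cis R).
Proof. by split; [exact: continuous_cos|exact: continuous_sin]. Qed.

Let rD (u v : R -> R) : continuous u -> continuous v ->
  continuous (fun t => u t + v t).
Proof. by move=> uc vc t; apply: (@cvgD _ R^o); [exact: uc|exact: vc]. Qed.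

Let rM (u v : R -> R) : continuous u -> continuous v ->
  continuous (fun t => u t * v t).
Proof. by move=> uc vc t; apply: cvgM; [exact: uc|exact: vc]. Qed.

Let rN (u : R -> R) : continuous u -> continuous (fun t => - u t).
Proof. by move=> uc t; apply: (@cvgN _ R^o); exact: uc. Qed.

Lemma ccontinuousD g h : ccontinuous g -> ccontinuous h ->
  ccontinuous (fun t => g t + h t).
Proof.
move=> [g1 g2] [h1 h2]; split.
  rewrite (_ : (fun _ => _) = (fun t => complex.Re (g t) + complex.Re (h t))).
    exact: rD.
  by apply/funext => x; rewrite raddfD.
rewrite (_ : (fun _ => _) = (fun t => complex.Im (g t) + complex.Im (h t))).
  exact: rD.
by apply/funext => x; rewrite raddfD.
Qed.

Lemma ccontinuousM g h : ccontinuous g -> ccontinuous h ->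
  ccontinuous (fun t => g t * h t).
Proof.
move=> [g1 g2] [h1 h2]; split.
  rewrite (_ : (fun _ => _) = (fun t => complex.Re (g t) * complex.Re (h t)
      + - (complex.Im (g t) * complex.Im (h t)))).
    by apply: rD; [exact: rM|apply: rN; exact: rM].
  by apply/funext => x; case: (g x) (h x) => ? ? [].
rewrite (_ : (fun _ => _) = (fun t => complex.Re (g t) * complex.Im (h t)
    + complex.Im (g t) * complex.Re (h t))).
  by apply: rD; exact: rM.
by apply/funext => x; case: (g x) (h x) => ? ? [].
Qed.

Lemma ccontinuousN g : ccontinuous g -> ccontinuous (fun t => - g t).
Proof.
move=> gc; rewrite (_ : (fun _ => _) = (fun t => (-1) * g t)).
  by apply: ccontinuousM => //; exact: ccontinuous_cst.
by apply/funext => t; rewrite mulN1r.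
Qed.

Lemma ccontinuous_normc g : ccontinuous g -> continuous (fun t => normc (g t) ^+ 2).
Proof.
move=> [g1 g2].
rewrite (_ : (fun _ => _) = (fun t => complex.Re (g t) * complex.Re (g t)
    + complex.Im (g t) * complex.Im (g t))).
  by apply: rD; exact: rM.
by apply/funext => x; rewrite normc_sqrE.
Qed.

Lemma ccontinuousV g : (forall t, g t != 0) -> ccontinuous g ->
  ccontinuous (fun t => (g t)^-1).
Proof.
move=> g0 gc; have nc := ccontinuous_normc gc; have [g1 g2] := gc.
have n0 t : normc (g t) ^+ 2 != 0.
  by rewrite sqrf_eq0; apply: contra_neq (g0 t) => /Normc.eq0_normc.
have iv : continuous (fun t => (normc (g t) ^+ 2)^-1).
  by move=> t; apply: cvgV => //; exact: nc.
split.
  rewrite (_ : (fun _ => _) = (fun t => complex.Re (g t) * (normc (g t) ^+ 2)^-1)).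
    exact: rM.
  by apply/funext => x; rewrite normc_sqrE; case: (g x).
rewrite (_ : (fun _ => _) = (fun t => - (complex.Im (g t) * (normc (g t) ^+ 2)^-1))).
  by apply: rN; exact: rM.
by apply/funext => x; rewrite normc_sqrE; case: (g x).
Qed.

Lemma ccontinuous_horner (p : {poly R[i]}) g : ccontinuous g ->
  ccontinuous (fun t => p.[g t]).
Proof.
move=> gc; elim/poly_ind: p => [|p c IH].
  by rewrite (_ : (fun _ => _) = fun=> 0); [exact: ccontinuous_cst|
    apply/funext => t; rewrite horner0].
rewrite (_ : (fun _ => _) = (fun t => p.[g t] * g t + c)).
  apply: ccontinuousD; last exact: ccontinuous_cst.
  exact: ccontinuousM.
by apply/funext => t; rewrite hornerMXaddC.
Qed.

Lemma ccontinuous_blaschke (zs : seq R[i]) : (forall a, a \in zs -> normc a < 1) ->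
  ccontinuous (fun t => blaschke zs (cis t)).
Proof.
elim: zs => [|a zs IH] zs1.
  rewrite (_ : (fun _ => _) = fun=> 1); first exact: ccontinuous_cst.
  by apply/funext => t; rewrite /blaschke big_nil.
have a1 : normc a < 1 by apply: zs1; rewrite mem_head.
rewrite (_ : (fun _ => _) = (fun t => (cis t + - a) * (1 + - (a^* * cis t))^-1
    * blaschke zs (cis t))); last by apply/funext => t; rewrite blaschke_cons.
have cc := ccontinuous_cst; have ce := ccontinuous_cis.
apply: ccontinuousM; last by apply: IH => b bz; apply: zs1; rewrite inE bz orbT.
apply: ccontinuousM; first exact: ccontinuousD.
apply: ccontinuousV => [t|]; first by rewrite denom_neq0 // normc_cis mulr1.
by apply: ccontinuousD => //; apply: ccontinuousN; exact: ccontinuousM.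
Qed.

End ComplexContinuity.

(** * The radius [s_star] and the polylogarithm *)

Section RadiusAndPolylog.
Variable R : realType.

(** Here [1 < m] is equivalent to [alpha < (1 - lambda) / (1 + lambda)], and
    [m < (lambda + lambda^-1) / 2] to [0 < alpha], for [lambda] in [(0, 1)].  As
    [x + 1 / x = 2 m] defines [s_star] and [x + 1 / x] increases for [x > 1],
    this gives the upper bound. *)
Lemma s_star_itv (lambda alpha : R) : 0 < lambda < 1 ->
  0 < alpha < (1 - lambda) / (1 + lambda) -> 1 < s_star lambda alpha < lambda^-1.
Proof.
move=> /andP[l0 l1] /andP[a0]; rewrite ltr_pdivlMr; last lra.
move=> al; rewrite /s_star; set m := _ / _.
have mE : m = (1 - alpha + (1 + alpha) * lambda ^+ 2) / (2 * lambda).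
  by rewrite /m; field; rewrite !gt_eqF.
have al2 : 0 < (1 - lambda - alpha * (1 + lambda)) * (1 - lambda).
  by rewrite mulr_gt0; lra.
have m1 : 1 < m by rewrite mE ltr_pdivlMr; lra.
have ml : m < (lambda + lambda^-1) / 2.
  have -> : (lambda + lambda^-1) / 2 = (lambda ^+ 2 + 1) / (2 * lambda).
    by field; rewrite gt_eqF.
  have al3 : 0 < alpha * (1 - lambda ^+ 2) by rewrite mulr_gt0 //; nra.
  by rewrite mE ltr_pM2r ?invr_gt0 ?mulr_gt0 //; lra.
have il : 1 < lambda^-1 by rewrite invf_gt1.
have ll : lambda * lambda^-1 = 1 by rewrite divff // gt_eqF.
apply/andP; split; first by have := sqrtr_ge0 (m ^+ 2 - 1); lra.
rewrite -ltrBrDl -[ltRHS]ger0_norm; last lra.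
rewrite -sqrtr_sqr ltr_sqrt ?exprn_gt0; nra.
Qed.

(** The first term of a convergent series of nonnegative terms. *)
Lemma polylog_ge (b x : R) : 0 <= b -> 0 < x < 1 -> x <= polylog b x.
Proof.
move=> b0 /andP[x0 x1]; rewrite /polylog.
set u := (fun n => _).
have tn (l : nat) : 0 <= x ^+ l / l%:R `^ b.
  by rewrite divr_ge0 ?powR_ge0 ?exprn_ge0 ?ltW.
have nu : nondecreasing_seq u.
  apply/nondecreasing_seqP => n; rewrite /u; case: n => [|n].
    by rewrite !big_geq.
  by rewrite [leRHS]big_nat_recr //= lerDl.
have cu : cvgn u.
  apply: nondecreasing_is_cvgn => //; exists (1 - x)^-1 => _ [n _ <-].
  apply: (@le_trans _ _ (\sum_(1 <= l < n) x ^+ l)).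
    rewrite /u big_seq [leRHS]big_seq; apply: ler_sum => l.
    rewrite mem_index_iota => /andP[l1 _].
    have h1 : 1 <= l%:R :> R by rewrite ler1n.
    have := ler_powR h1 b0; rewrite powRr0 => hb.
    by rewrite ler_pdivrMr ?powR_gt0 ?ltr0n // ler_peMr // exprn_ge0 // ltW.
  apply: (@le_trans _ _ (\sum_(0 <= l < n) x ^+ l)).
    case: n => [|n]; first by rewrite !big_geq.
    by rewrite [leRHS]big_nat_recl // [leLHS]big_add1 /= expr0 lerDr.
  rewrite big_mkord -[leRHS]mul1r ler_pdivlMr ?subr_gt0 //.
  have := subrX1 x n; have : 0 <= x ^+ n by rewrite exprn_ge0 ?ltW.
  lra.
apply: le_trans (nondecreasing_cvgn_le nu cu 2).
by rewrite /u big_nat1 powR1 divr1.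
Qed.

End RadiusAndPolylog.

(** * The lower bound for the distance *)

Section Final.
Variable R : realType.

Lemma le_of_small_errors (a b k : R) : 0 <= k ->
  (forall e, 0 < e <= 1 -> a <= b + e * k) -> a <= b.
Proof.
move=> k0 H; apply/ler_addgt0Pr => e e0.
have ke : 0 < k + e by lra.
have e'0 : 0 < e / (k + e) by rewrite divr_gt0.
have e'1 : e / (k + e) <= 1 by rewrite ler_pdivrMr // mul1r; lra.
have := H (e / (k + e)); rewrite e'0 e'1 => /(_ isT) /le_trans; apply.
rewrite lerD2l mulrAC ler_pdivrMr //; nra.
Qed.

(** Letting [e] tend to [0] in [blaschke_grid_bound], after averaging over the
    rotations. *)
Lemma blaschke_integral_ge (l s : R) (zs : seq R[i]) (L n : nat) (p q : {poly R[i]}) :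
    0 <= l -> 1 < s -> l * s < 1 -> (forall a, a \in zs -> normc a <= l) ->
    (size p <= n.+1)%N -> (size q <= n.+1)%N ->
    (forall z, normc z = 1 -> q.[z] != 0) -> (0 < L)%N ->
  ((((size zs)%:R - n%:R - ((s - l) / (1 - l * s)) ^+ (2 * size zs)
               / (s ^+ (2 * L) * (s ^+ 2 - 1))) / L%:R)%:E <=
  (2 * pi)^-1%:E * \int[lebesgue_measure]_(t in `[0%R, (2 * pi)%R])
     (normc (blaschke zs (cis t) - p.[cis t] / q.[cis t]) ^+ 2)%:E)%E.
Proof.
move=> l0 s1 ls zsl pn qn q0 L0.
set tau := _ / (s ^+ _ * _); set I := (\int[_]_(_ in _) _)%E.
have pi0 : 0 < 2 * pi :> R by rewrite mulr_gt0 // pi_gt0.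
have L0' : 0 < L%:R :> R by rewrite ltr0n.
pose h t := normc (blaschke zs (cis t) - p.[cis t] / q.[cis t]) ^+ 2.
have hc : continuous h.
  apply: ccontinuous_normc; apply: ccontinuousD.
    by apply: ccontinuous_blaschke => a /zsl al; nra.
  apply: ccontinuousN; apply: ccontinuousM.
    exact: (ccontinuous_horner _ (@ccontinuous_cis R)).
  apply: ccontinuousV => [t|]; first by rewrite q0 // normc_cis.
  exact: (ccontinuous_horner _ (@ccontinuous_cis R)).
have I0 : (0 <= I)%E by apply: integral_ge0 => t _; rewrite lee_fin sqr_ge0.
have [/eqP|Ioo] := boolP (I == +oo%E).
  by move=> ->; rewrite gt0_muley ?leey // lte_fin invr_gt0.
have [r Ir] : exists r, I = r%:E.
  by case: I I0 Ioo => // r _ _; exists r.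
rewrite Ir -EFinM lee_fin ler_pdivrMr //; set A := _^-1 * r.
have tau0 : 0 <= tau.
  rewrite divr_ge0 //; first by rewrite mulnC exprM sqr_ge0.
  have s21 : 0 <= s ^+ 2 - 1 by nra.
  by rewrite mulr_ge0 // exprn_ge0 //; lra.
have A0 : 0 <= A by rewrite mulr_ge0 ?invr_ge0 ?(ltW pi0) // -lee_fin -Ir.
apply: (@le_of_small_errors _ _ (1 + 3 * (n%:R + tau) + L%:R * (A + 2))).
  by rewrite !addr_ge0 ?mulr_ge0 ?addr_ge0.
move=> e /andP[e0 e1]; have e01 : 0 < e <= 1 by rewrite e0.
have [M M0 grid] := blaschke_grid_bound L l0 s1 ls zsl pn qn q0 e01.
have M0' : 0 < M%:R :> R by rewrite ltr0n.
pose D := (size zs)%:R - e - (n%:R + tau) * (1 + e) ^+ 2.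
pose B := (D / L%:R - (e + e ^+ 2)) / (1 + e).
have /= := @integral_ge_grid_sums R h M (2 * pi) B hc M0 pi0.
rewrite -/I Ir lee_fin => HB.
have {HB}BA : B <= A.
  rewrite /A [leRHS]mulrC ler_pdivlMr // [leLHS]mulrC; apply: HB => x.
  rewrite -[B *+ M]mulr_natr -ler_pdivlMr // [leRHS]mulrC.
  have := grid x; rewrite -/tau -/D /grid_mean => gx.
  rewrite /B ler_pdivrMr; last lra.
  by rewrite lerBlDr ler_pdivrMr //; move: gx; rewrite /h; lra.
have : D <= L%:R * ((1 + e) * A + (e + e ^+ 2)).
  move: BA; rewrite /B ler_pdivrMr; last lra.
  by rewrite lerBlDr ler_pdivrMr //; lra.
have ee : e ^+ 2 <= e by nra.
have nt0 : 0 <= n%:R + tau by rewrite addr_ge0.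
have h1 : (n%:R + tau) * (1 + e) ^+ 2 <= (n%:R + tau) * (1 + 3 * e).
  by rewrite ler_wpM2l //; nra.
have h2 : L%:R * ((1 + e) * A + (e + e ^+ 2)) <= L%:R * (A + e * (A + 2)).
  by rewrite ler_wpM2l ?(ltW L0') //; nra.
rewrite /D; lra.
Qed.

(** The radicand is [(alpha / N) * (N - n - N * X)], where [N * X] is [tau]
    multiplied by [(n + 1)^beta * Li_beta(s^-2) * s^4 / (s^2 - 1)].  This factor
    is at least [1], and [alpha / N <= 1 / L]. *)
Lemma radicand_le (n N : nat) (lambda alpha beta : R) :
    let s := s_star lambda alpha in let L := `|Num.floor (N%:R / alpha)|%N in
    0 < lambda < 1 -> 0 < alpha < (1 - lambda) / (1 + lambda) -> (0 < N)%N ->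
    0 <= beta -> 0 <= radicand n N lambda alpha beta ->
  (0 < L)%N /\
  radicand n N lambda alpha beta <=
    (N%:R - n%:R - ((s - lambda) / (1 - lambda * s)) ^+ (2 * N)
                     / (s ^+ (2 * L) * (s ^+ 2 - 1))) / L%:R.
Proof.
move=> s L hl ha N0 b0 rad0.
have /andP[s1 sl] := s_star_itv hl ha; rewrite -/s in s1 sl.
move: hl ha => /andP[l0 l1] /andP[a0 al].
have N0' : 0 < N%:R :> R by rewrite ltr0n.
have N1 : 1 <= N%:R :> R by rewrite ler1n.
have a1 : alpha < 1 by rewrite (lt_le_trans al) // ler_pdivrMr; lra.
have Na : 1 <= N%:R / alpha by rewrite ler_pdivlMr //; lra.
have floor0 : 0 < Num.floor (N%:R / alpha) by rewrite floor_gt0.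
have LE : Num.floor (N%:R / alpha) = L%:Z by rewrite /L gez0_abs // ltW.
have L0 : (0 < L)%N by rewrite -ltz_nat -LE.
have L0' : 0 < L%:R :> R by rewrite ltr0n.
split => //.
have Lle : L%:R <= N%:R / alpha.
  by have := floor_le (N%:R / alpha); rewrite LE.
move: rad0; rewrite /radicand -/s LE.
set k := ((s - lambda) / (1 - lambda * s)) ^+ (2 * N).
have s0 : 0 < s by lra.
have s21 : 0 < s ^+ 2 - 1 by nra.
have sE : s ^ (2 * (2 - L%:Z)) = s ^+ 4 / s ^+ (2 * L).
  by rewrite mulrBr expfzDr ?gt_eqF // -invr_expz.
rewrite sE.
have sL : 0 < s ^+ (2 * L) by rewrite exprn_gt0.
have k0 : 0 <= k by rewrite /k mulnC exprM sqr_ge0.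
have pl : s ^- 2 <= polylog beta (s ^- 2).
  apply: polylog_ge => //; rewrite invr_gt0 exprn_gt0 //= invf_lt1 ?exprn_gt0 //.
  lra.
have n1 : 1 <= n.+1%:R `^ beta.
  have h1 : 1 <= n.+1%:R :> R by rewrite ler1n.
  by have := ler_powR h1 b0; rewrite powRr0.
set X := k * _ * _ * _.
have Xge : k / (s ^+ (2 * L) * (s ^+ 2 - 1)) <= N%:R * X.
  have -> : N%:R * X = k * (n.+1%:R `^ beta * (polylog beta (s ^- 2) * s ^+ 4)
      / (s ^+ 2 - 1)) / (s ^+ (2 * L) * (s ^+ 2 - 1)).
    by rewrite /X; field; rewrite !gt_eqF.
  rewrite ler_pM2r ?invr_gt0 ?mulr_gt0 // ler_peMr // ler_pdivlMr // mul1r.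
  have s2 : s ^+ 2 <= polylog beta (s ^- 2) * s ^+ 4.
    rewrite [s ^+ 4](exprD s 2 2) mulrA ler_peMl ?sqr_ge0 //.
    have := ler_wpM2r (ltW (exprn_gt0 2 s0)) pl.
    by rewrite mulVf ?gt_eqF ?exprn_gt0.
  have : polylog beta (s ^- 2) * s ^+ 4 <=
      n.+1%:R `^ beta * (polylog beta (s ^- 2) * s ^+ 4).
    by rewrite ler_peMl // (le_trans _ s2) // exprn_ge0 // ltW.
  lra.
have -> : alpha * (1 - n%:R / N%:R - X) = (N%:R - n%:R - N%:R * X) * (alpha / N%:R).
  by field; rewrite gt_eqF.
have aN : 0 < alpha / N%:R by rewrite divr_gt0.
rewrite pmulr_lge0 // => r0.
have : alpha / N%:R <= L%:R^-1.
  by rewrite -[leLHS]invrK lef_pV2 ?posrE ?invr_gt0 // invf_div.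
by move=> aL; rewrite ler_pM // ?(ltW aN) //; lra.
Qed.

End Final.

Theorem theorem3 (R : realType) (n N : nat) (f : R[i] -> R[i]) (lambda alpha : R)
    (hnN : (n < N)%N)
    (hf : finite_blaschke N f)
    (hlambda : 0 < lambda < 1)
    (hzeros : forall z : R[i], `|z| < 1 -> f z = 0 -> normc z <= lambda)
    (halpha : 0 < alpha < (1 - lambda) / (1 + lambda)) :
  1 < s_star lambda alpha < lambda^-1 /\
  (ereal_sup [set (Num.sqrt (radicand n N lambda alpha beta))%:E |
                beta in [set b : R | (0 <= b <= 1)%R
                                     /\ (0 <= radicand n N lambda alpha b)%R]]
   <= dist2_rat f n)%E.
Proof.
have hs := s_star_itv hlambda halpha; split=> //.
have /andP[s1 sl] := hs; have /andP[l0 l1] := hlambda.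
apply: ge_ereal_sup => _ [beta [/andP[b0 _] rad0] <-].
apply: le_ereal_inf_tmp => _ [_ [p [q [pn qn q0 ->]]] <-].
have [c [zeta [c1 zeta1 fE]]] := hf.
pose zs := [seq zeta i | i <- enum 'I_N].
have szs : size zs = N by rewrite size_map -cardE card_ord.
have fB z : f z = c * blaschke zs z.
  by rewrite fE /blaschke big_map big_enum.
have c0 : c != 0 by rewrite -normr_eq0 c1 oner_eq0.
have zsl a : a \in zs -> normc a <= lambda.
  move=> /mapP[i _ ->]; apply: hzeros => //.
  by rewrite fE (bigD1 i) //= subrr !mul0r mulr0.
have ls : lambda * s_star lambda alpha < 1.
  by rewrite mulrC -ltr_pdivlMr // div1r.
have [L0 radL] := radicand_le hlambda halpha (leq_ltn_trans (leq0n n) hnN) b0 rad0.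
set L := `|_|%N in L0 radL.
have q0' z : normc z = 1 -> q.[z] != 0.
  by move=> /eqP; rewrite normc_eq1 => /eqP /q0; rewrite rootE.
have pn' : (size (c^-1 *: p) <= n.+1)%N by rewrite (leq_trans (size_scale_leq _ _)).
(* Dividing by the unimodular constant [c] moves it to the numerator [p]. *)
have := blaschke_integral_ge (ltW l0) s1 ls zsl pn' qn q0' L0.
rewrite szs.
rewrite /normL2.
set I1 := (\int[_]_(_ in _) _)%E; set I2 := (\int[_]_(_ in _) _)%E.
have -> : I1 = I2.
  apply: eq_integral => t _; congr (_ ^+ 2)%:E.
  have -> : f (cis t) - p.[cis t] / q.[cis t] =
      c * (blaschke zs (cis t) - (c^-1 *: p).[cis t] / q.[cis t]).
    by rewrite fB hornerZ mulrBr !mulrA divff // mul1r.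
  have nc : normc c = 1 by apply/eqP; rewrite normc_eq1 c1.
  by rewrite Normc.normcM nc mul1r.
move=> I2ge.
have radI : ((radicand n N lambda alpha beta)%:E <= (2 * pi)^-1%:E * I2)%E.
  by apply: le_trans I2ge; rewrite lee_fin.
have -> : (Num.sqrt (radicand n N lambda alpha beta))%:E =
    ((radicand n N lambda alpha beta)%:E `^ 2^-1)%E.
  by rewrite poweR_EFin powR12_sqrt.
apply: gt0_ler_poweR => //; rewrite in_itv /= leey andbT ?lee_fin //.
by rewrite (le_trans _ radI) // lee_fin.
Qed.
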